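(* Let $n\ge 1$, let $\rho$ be any $n$-photon state (a density operator on $(\mathbb{C}^2)^{\otimes n}$ supported on the symmetric subspace), and let $U$ be any unitary on $\mathbb{C}^2$. Then Situation 1 and Situation 2 (defined in the context), run with the same input state $\rho$ and the same unitary $U$, produce the same output statistics: for each $i\in\{0,1\}$, the probability that Situation 1 outputs bit $i$ equals the probability that Situation 2 outputs bit $i$.
   Context: Single-photon polarization states live in $\mathbb{C}^2$ with orthonormal basis $|0\rangle,|1\rangle$. An $n$-photon state is a density operator $\rho$ on $(\mathbb{C}^2)^{\otimes n}$ with bosonic symmetry, i.e. a mixture of pure states lying in the symmetric subspace of $(\mathbb{C}^2)^{\otimes n}$. The universal squash operation $\Lambda_{n\to1}$ is the partial trace of $\rho$ over any $n-1$ of the $n$ tensor factors (by symmetry the result does not depend on which ones); its output is a density operator on $\mathbb{C}^2$. Situation 1: the input $\rho$ is mapped to $\Lambda_{n\to1}(\rho)$, then to $U\Lambda_{n\to1}(\rho)U^\dagger$, and the resulting qubit is measured in the basis $\{|0\rangle,|1\rangle\}$; the output is the measured bit. So bit $i$ has probability $\langle i|U\Lambda_{n\to1}(\rho)U^\dagger|i\rangle$. Situation 2: the input $\rho$ is mapped to $\rho'=U^{\otimes n}\rho(U^\dagger)^{\otimes n}$ and each photon is measured in $\{|0\rangle,|1\rangle\}$ by two photon-number-resolving detectors, which report the numbers $(k_0,k_1)$, $k_0+k_1=n$, of photons found in $|0\rangle$ and $|1\rangle$; so $(k_0,k_1)$ occurs with probability $\sum_{\mathbf{x}}\langle\mathbf{x}|\rho'|\mathbf{x}\rangle$,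 the sum being over bit strings $\mathbf{x}\in\{0,1\}^n$ with exactly $k_0$ zeros and $k_1$ ones. A classical post-processor then outputs bit $i$ with probability $k_i/(k_0+k_1)$, $i=0,1$. *)

(* Defs.v *)
From mathcomp Require Export all_boot all_order all_algebra perm.
From mathcomp Require Export reals.
From mathcomp.real_closed Require Export complex.

Set Implicit Arguments.
Unset Strict Implicit.
Unset Printing Implicit Defensive.

Import Order.TTheory GRing.Theory Num.Theory.
Local Open Scope ring_scope.
Local Open Scope sesquilinear_scope.
Local Open Scope complex_scope.

(* The computational basis of (C^2)^{(x) n} is indexed by the bit strings of
   length n.  As MathComp matrices are indexed by ordinals, [idx] and [str]
   are a bijection between bit strings and row/column numbers; which
   bijection is used is irrelevant. *)
Definition bits (n : nat) : finType := {ffun 'I_n -> 'I_2}.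
Definition hdim (n : nat) : nat := #|{: bits n}|.
Definition idx n (x : bits n) : 'I_(hdim n) := enum_rank x.
Definition str n (r : 'I_(hdim n)) : bits n := enum_val r.

Definition permute n (sigma : 'S_n) (x : bits n) : bits n :=
  [ffun k => x (sigma k)].

(* The n-bit string with bit a in position j and the bits of z, in order, in
   the other n - 1 positions. *)
Definition insert_bit n (j : 'I_n) (a : 'I_2) (z : bits n.-1) : bits n :=
  [ffun k => if unlift j k is Some k' then z k' else a].

Definition bit_count n (x : bits n) (i : 'I_2) : nat :=
  #|[set l | x l == i]|.

(* A report (k_0, k_1) of the two photon-number-resolving detectors. *)
Definition outcome (n : nat) : finType := {ffun 'I_2 -> 'I_n.+1}.
Definition outcome_total n (k : outcome n) : nat := (k 0%R + k 1%R)%N.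

Section Squash.
Variable R : realType.
Local Notation C := (R[i]).

Definition ket m (e : 'I_m) : 'cV[C]_m := delta_mx e 0.

Definition born m (X : 'M[C]_m) (e : 'I_m) : C :=
  ((ket e) ^t* *m X *m ket e) 0 0.

(* In the order of R[i], 0 <= z means that z is real and nonnegative. *)
Definition density m (rho : 'M[C]_m) : Prop :=
  [/\ rho \is hermsymmx,
      forall v : 'cV[C]_m, 0 <= (v ^t* *m rho *m v) 0 0
    & \tr rho = 1].

Definition in_sym n (v : 'cV[C]_(hdim n)) : Prop :=
  forall (sigma : 'S_n) (x : bits n), v (idx (permute sigma x)) 0 = v (idx x) 0.

(* The support of a Hermitian operator is its range. *)
Definition photon_state n (rho : 'M[C]_(hdim n)) : Prop :=
  density rho /\ forall v : 'cV[C]_(hdim n), in_sym (rho *m v).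

Definition tens_pow n (A : 'M[C]_2) : 'M[C]_(hdim n) :=
  \matrix_(r, s) \prod_(l < n) A (str r l) (str s l).

(* Partial trace over all the tensor factors except the j-th. *)
Definition squash n (j : 'I_n) (rho : 'M[C]_(hdim n)) : 'M[C]_2 :=
  \matrix_(a, b) \sum_(z : bits n.-1)
    rho (idx (insert_bit j a z)) (idx (insert_bit j b z)).

Definition situation1 n (j : 'I_n) (rho : 'M[C]_(hdim n)) (U : 'M[C]_2)
    (i : 'I_2) : C :=
  born (U *m squash j rho *m U ^t*) i.

Definition outcome_prob n (rho' : 'M[C]_(hdim n)) (k : outcome n) : C :=
  \sum_(x : bits n | [forall i, bit_count x i == k i]) born rho' (idx x).

Definition postprocess n (k : outcome n) (i : 'I_2) : C :=
  (k i)%:R / (outcome_total k)%:R.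

Definition situation2 n (rho : 'M[C]_(hdim n)) (U : 'M[C]_2) (i : 'I_2) : C :=
  let rho' := tens_pow n U *m rho *m tens_pow n (U ^t*) in
  \sum_(k : outcome n | outcome_total k == n)
    outcome_prob rho' k * postprocess k i.

End Squash.

(* Main.v *)
(** Situation 2 outputs [i] with probability [\sum_x <x|rho'|x> * (number of [l]
    with [x l = i]) / n]; exchanging the two sums, this is the average over the
    photons [l] of the probability that photon [l] is found in [|i>].  As [rho'] is
    diagonally permutation invariant, all these probabilities are equal to that of
    photon [j], which is a diagonal entry of the reduced state of [rho'].  Finally
    the partial trace intertwines the action of [U^{(x) n}] with that of [U], the
    traced-out factors cancelling by unitarity. *)
Require Import Defs.

Set Implicit Arguments.
Unset Strict Implicit.
Unset Printing Implicit Defensive.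

Import Order.TTheory GRing.Theory Num.Theory.
Local Open Scope ring_scope.
Local Open Scope sesquilinear_scope.
Local Open Scope complex_scope.

Lemma idxK n : cancel (@idx n) (@str n).
Proof. exact: enum_rankK. Qed.

Lemma strK n : cancel (@str n) (@idx n).
Proof. exact: enum_valK. Qed.

Lemma sum_idx (V : nmodType) n (F : 'I_(hdim n) -> V) :
  \sum_r F r = \sum_(x : bits n) F (idx x).
Proof. by rewrite (reindex (@idx n)) //; apply/onW_bij/enum_rank_bij. Qed.

Lemma permute_bij n (s : 'S_n) : bijective (permute s).
Proof.
by exists (permute s^-1) => y; apply/ffunP => k; rewrite !ffunE ?permK ?permKV.
Qed.

Lemma insert_bit_eq n (j : 'I_n) a z : insert_bit j a z j = a.
Proof. by rewrite ffunE unlift_none. Qed.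

Lemma insert_bit_lift n (j : 'I_n) a z k : insert_bit j a z (lift j k) = z k.
Proof. by rewrite ffunE liftK. Qed.

(** Splitting a bit string into its bit at [j] and the remaining string is a bijection; this
    separates the kept photon from the traced-out ones. *)
Lemma sum_insert_bit (V : nmodType) n (j : 'I_n) (F : bits n -> V) :
  \sum_x F x = \sum_a \sum_z F (insert_bit j a z).
Proof.
rewrite pair_big /= (reindex (fun p => insert_bit j p.1 p.2)) //.
apply: onW_bij.
exists (fun x : bits n => (x j, [ffun k => x (lift j k)])) => [[a z]|x] /=.
  rewrite insert_bit_eq; congr pair.
  by apply/ffunP => k; rewrite ffunE insert_bit_lift.
by apply/ffunP => k; rewrite ffunE; case: unliftP => [k'|] ->; rewrite ?ffunE.
Qed.

Lemma sum_bit_count n (x : bits n) (i : 'I_2) :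
  bit_count x i = (\sum_(l < n) (x l == i))%N.
Proof. by rewrite /bit_count -sum1dep_card big_mkcond. Qed.

Lemma bit_count_ltn n (x : bits n) i : (bit_count x i < n.+1)%N.
Proof. by rewrite ltnS -{2}(card_ord n) max_card. Qed.

Lemma bit_count_total n (x : bits n) : (bit_count x 0%R + bit_count x 1%R = n)%N.
Proof.
rewrite !sum_bit_count -big_split /= -[RHS]card_ord -sum1_card.
by apply: eq_bigr => l _; case: (x l) => [[|[|m]]].
Qed.

Section Squash.
Variable R : realType.
Local Notation C := (R[i]).

Lemma bornE m (X : 'M[C]_m) e : born X e = X e e.
Proof.
rewrite /born /ket.
have -> : (delta_mx e 0 : 'cV[C]_m) ^t* = delta_mx 0 e.
  by rewrite trmx_delta map_delta_mx.
by rewrite -rowE -colE !mxE.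
Qed.

Lemma tens_powE n (A : 'M[C]_2) (x y : bits n) :
  tens_pow n A (idx x) (idx y) = \prod_l A (x l) (y l).
Proof. by rewrite mxE !idxK. Qed.

Lemma tens_pow_permute n (A : 'M[C]_2) (s : 'S_n) (x y : bits n) :
  tens_pow n A (idx (permute s x)) (idx (permute s y)) =
  tens_pow n A (idx x) (idx y).
Proof.
rewrite !tens_powE [RHS](reindex_inj (@perm_inj _ s)) /=.
by apply: eq_bigr => l _; rewrite !ffunE.
Qed.

Lemma tens_pow_insert_bit n (A : 'M[C]_2) (j : 'I_n) a b (z w : bits n.-1) :
  tens_pow n A (idx (insert_bit j a z)) (idx (insert_bit j b w)) =
  A a b * tens_pow n.-1 A (idx z) (idx w).
Proof.
(* ['I_0] is empty, and at a successor [n.-1] computes, so the factor at [j] can be split off. *)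
case: n j z w => [[]//|n] j z w.
rewrite !tens_powE (bigD1_ord j) //= !insert_bit_eq; congr (_ * _).
by apply: eq_bigr => k _; rewrite !insert_bit_lift.
Qed.

Lemma tens_pow_mul n (A B : 'M[C]_2) :
  tens_pow n A *m tens_pow n B = tens_pow n (A *m B).
Proof.
apply/matrixP => r s; rewrite -(strK r) -(strK s) tens_powE mxE sum_idx.
under [RHS]eq_bigr do rewrite mxE.
(* A product over photons of sums over one bit expands to a sum over whole bit strings, the
   intermediate index of the matrix product. *)
rewrite bigA_distr_bigA /=; apply: eq_bigr => x _.
by rewrite !tens_powE -big_split.
Qed.

Lemma tens_pow1 n : tens_pow n (1%:M : 'M[C]_2) = 1%:M.
Proof.
apply/matrixP => r s; rewrite -(strK r) -(strK s) tens_powE mxE.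
rewrite (inj_eq (can_inj (@idxK n))).
case: eqP => [->|/eqP neq]; first by apply: big1 => l _; rewrite mxE eqxx.
have [l xl] : exists l, str r l != str s l.
  by apply/existsP; rewrite -negb_forall; apply: contra neq => /eqfunP/ffunP/eqP.
by rewrite (bigD1 l) //= mxE (negbTE xl) mul0r.
Qed.

Lemma mulmx3E n m (A : 'M[C]_(m, n)) (X : 'M[C]_n) (B : 'M[C]_(n, m)) a b :
  (A *m X *m B) a b = \sum_r \sum_s A a r * X r s * B s b.
Proof.
rewrite mxE exchange_big /=; apply: eq_bigr => s _.
by rewrite mxE mulr_suml.
Qed.

(** The factors at [j] come out of the partial trace; on the other photons, summing over the traced
    index [z] forms the entries of a tensor power of [B *m A], the identity. *)
Lemma squash_conj n (j : 'I_n) (A B : 'M[C]_2) (X : 'M[C]_(hdim n)) :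
  B *m A = 1%:M ->
  squash j (tens_pow n A *m X *m tens_pow n B) = A *m squash j X *m B.
Proof.
move=> BA1; apply/matrixP => a b.
have BA1n (v w : bits n.-1) :
    \sum_z tens_pow n.-1 B (idx v) (idx z) * tens_pow n.-1 A (idx z) (idx w)
    = (v == w)%:R.
  have /matrixP/(_ (idx v) (idx w)) := tens_pow_mul n.-1 B A.
  by rewrite BA1 tens_pow1 !mxE sum_idx (inj_eq (can_inj (@idxK _))).
rewrite mulmx3E mxE.
under eq_bigr => z _.
  rewrite mulmx3E sum_idx (sum_insert_bit j).
  under eq_bigr => c _.
    under eq_bigr => w _ do rewrite sum_idx (sum_insert_bit j).
    over.
  over.
rewrite exchange_big /=; apply: eq_bigr => c _.
under eq_bigr do rewrite exchange_big /=.
rewrite exchange_big /=; apply: eq_bigr => d _.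
rewrite mxE mulr_sumr mulr_suml exchange_big /=; apply: eq_bigr => w _.
rewrite exchange_big /=.
(* The sum over [z] is now innermost and [BA1n] collapses it, leaving only [v = w]. *)
transitivity (\sum_v A a c * X (idx (insert_bit j c w)) (idx (insert_bit j d v)) *
                     B d b * (v == w)%:R).
  apply: eq_bigr => v _; rewrite -BA1n mulr_sumr; apply: eq_bigr => z _.
  rewrite !tens_pow_insert_bit [A a c * _ * _]mulrAC mulrACA.
  by congr (_ * _); exact: mulrC.
rewrite (bigD1 w) //= eqxx mulr1 big1 ?addr0 // => v /negbTE ->.
by rewrite mulr0.
Qed.

(** Each column of [rho] is the image of a basis vector, hence symmetric; hermiticity carries this
    over to the rows. *)
Lemma photon_state_permute n (rho : 'M[C]_(hdim n)) (s : 'S_n) (x y : bits n) :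
  photon_state rho ->
  rho (idx (permute s x)) (idx (permute s y)) = rho (idx x) (idx y).
Proof.
move=> [[/is_hermitianmxP herm _ _] sym].
have rowsym x' y' : rho (idx (permute s x')) (idx y') = rho (idx x') (idx y').
  by have := sym (delta_mx (idx y') 0) s x'; rewrite -colE !mxE.
have hermE r t : rho r t = (rho t r)^*.
  by rewrite {1}herm expr0 scale1r !mxE.
by rewrite rowsym hermE rowsym -hermE.
Qed.

Lemma tens_pow_conj_permute n (rho : 'M[C]_(hdim n)) (A B : 'M[C]_2)
    (s : 'S_n) (x : bits n) :
  photon_state rho ->
  let rho' := tens_pow n A *m rho *m tens_pow n B in
  rho' (idx (permute s x)) (idx (permute s x)) = rho' (idx x) (idx x).
Proof.
move=> hrho /=.
rewrite !mulmx3E !sum_idx (reindex (permute s)) /=; last exact/onW_bij/permute_bij.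
apply: eq_bigr => y _.
rewrite !sum_idx (reindex (permute s)) /=; last exact/onW_bij/permute_bij.
by apply: eq_bigr => z _; rewrite !tens_pow_permute photon_state_permute.
Qed.

(** Each bit string triggers exactly one report, [count x], whose total is [n]; grouping the strings
    by report gives the sum over outcomes. *)
Lemma situation2_sum_bits n (rho : 'M[C]_(hdim n)) (U : 'M[C]_2) i :
  let rho' := tens_pow n U *m rho *m tens_pow n (U ^t*) in
  situation2 rho U i =
  \sum_(x : bits n) rho' (idx x) (idx x) * ((bit_count x i)%:R / n%:R).
Proof.
rewrite /situation2 /=; set rho' := _ *m _.
pose count (x : bits n) : outcome n := [ffun a => Ordinal (bit_count_ltn x a)].
rewrite (partition_big count (fun k => outcome_total k == n)) /=; last first.
  by move=> x _; rewrite /outcome_total !ffunE /= bit_count_total.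
apply: eq_bigr => k /eqP k_n; rewrite mulr_suml.
apply: eq_big => [x|x /eqfunP xk]; last by rewrite bornE /postprocess k_n xk.
apply/eqfunP/eqP => [xk|<- a]; last by rewrite ffunE.
by apply/ffunP => a; apply/val_inj; rewrite ffunE /= xk.
Qed.

Lemma squash_diag n (j : 'I_n) (X : 'M[C]_(hdim n)) i :
  squash j X i i = \sum_(x : bits n) X (idx x) (idx x) * (x j == i)%:R.
Proof.
rewrite mxE (sum_insert_bit j) (bigD1 i) //= [X in _ + X]big1 ?addr0.
  by apply: eq_bigr => z _; rewrite insert_bit_eq eqxx mulr1.
move=> a /negbTE ai; apply: big1 => z _.
by rewrite insert_bit_eq ai mulr0.
Qed.

End Squash.

Theorem theorem1 (R : realType) (n : nat) (hn : (1 <= n)%N)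
    (rho : 'M[R[i]]_(hdim n)) (hrho : photon_state rho)
    (U : 'M[R[i]]_2) (hU : U \is unitarymx)
    (j : 'I_n) (i : 'I_2) :
  situation1 j rho U i = situation2 rho U i.
Proof.
(* [squash_conj] needs the product in this order, opposite to the one in [unitarymxP]. *)
have UU1 : U ^t* *m U = 1%:M by apply/mulmx1C/unitarymxP.
rewrite /situation1 bornE -squash_conj // squash_diag situation2_sum_bits /=.
set rho' := _ *m _.
have same_photon l :
    \sum_(x : bits n) rho' (idx x) (idx x) * (x l == i)%:R =
    \sum_(x : bits n) rho' (idx x) (idx x) * (x j == i)%:R.
  (* Exchanging photons [l] and [j] puts the bit [x j] in position [l] and preserves the diagonal of
     [rho']. *)
  rewrite (reindex_inj (h := permute (tperm l j))) /=.
    apply: eq_bigr => x _.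
    by rewrite tens_pow_conj_permute // ffunE tpermL.
  exact/bij_inj/permute_bij.
under [RHS]eq_bigr do
  rewrite sum_bit_count natr_sum mulrA mulr_sumr.
(* The sum over [l] has [n] equal terms, which cancels the division by [n], nonzero by [hn]. *)
rewrite -mulr_suml exchange_big /= (eq_bigr _ (fun l _ => same_photon l)).
rewrite sumr_const card_ord -[X in X / _]mulr_natr mulfK //.
by rewrite pnatr_eq0 -lt0n.
Qed.
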